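(* The Mathieu group $M_{24}$, in its natural action on $24$ points, has the $k$-et property for all $k$ with $1\le k\le 7$, but not for any $k$ with $8\le k\le 12$.
   Context: A $k$-partition of $\Omega$ is a partition into exactly $k$ nonempty parts; a section is a set containing exactly one point of each part. A permutation group $G$ on a finite set $\Omega$ has the $k$-et property if there is a $k$-subset $S$ of $\Omega$ such that for every $k$-partition $\mathcal{P}$ of $\Omega$ there is $g\in G$ with $Sg$ a section of $\mathcal{P}$. *)

(* Defs.v *)
From mathcomp Require Import all_boot all_fingroup all_algebra.
From mathcomp Require finfield.

Set Implicit Arguments.
Unset Strict Implicit.
Unset Printing Implicit Defensive.

Import GRing.Theory.

Definition k_et (T : finType) (G : {group {perm T}}) (k : nat) : Prop :=
  exists2 S : {set T}, #|S| = k &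
    forall P : {set {set T}}, partition P [set: T] -> #|P| = k ->
      exists2 g : {perm T}, g \in G & is_transversal (g @: S) P [set: T].

(* The projective line over 'F_23, with None as the point at infinity. *)
Definition PL23 : finType := option 'F_23.

Section Mathieu24.

Local Open Scope ring_scope.

Definition qr23 (x : 'F_23) : bool := [exists y : 'F_23, x == y ^+ 2].

Definition alpha_fun (p : PL23) : PL23 :=
  if p is Some x then Some (x + 1) else None.

Definition gamma_fun (p : PL23) : PL23 :=
  if p is Some x then (if x == 0 then None else Some (- x^-1)) else Some 0.

Definition delta_fun (p : PL23) : PL23 :=
  if p is Some x then Some (if qr23 x then x ^+ 3 / 9%:R else 9%:R * x ^+ 3)
  else None.

Lemma alpha_inj : injective alpha_fun.
Proof.
case=> [x|] [y|] //; rewrite /alpha_fun.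
by move=> /Some_inj /addIr ->.
Qed.

Lemma gamma_inj : injective gamma_fun.
Proof.
apply: (can_inj (g := gamma_fun)); case=> [x|]; rewrite /gamma_fun ?eqxx //.
have [->|x0] := eqVneq x 0; first by [].
by rewrite oppr_eq0 invr_eq0 (negPf x0) invrN invrK opprK.
Qed.

Lemma nine_neq0 : (9%:R : 'F_23) != 0.
Proof. by []. Qed.

Lemma expF23_45 (x : 'F_23) : (x ^+ 3) ^+ 15 = x.
Proof.
have Fx : x ^+ 23 = x by have := finfield.expf_card x; rewrite card_Fp.
by rewrite -exprM -[(3 * 15)%N]/(23 + 22)%N exprD Fx -exprS Fx.
Qed.

Lemma cube_inj : injective (fun x : 'F_23 => x ^+ 3).
Proof. exact: (can_inj (g := fun z => z ^+ 15)) expF23_45. Qed.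

Lemma qr23_cube_mix (x y : 'F_23) :
  qr23 x -> x ^+ 3 / 9%:R = 9%:R * y ^+ 3 -> qr23 y.
Proof.
have n9 := nine_neq0.
move=> /existsP[z /eqP->] E.
apply/existsP; exists ((z ^+ 3 / 9%:R) ^+ 15); apply/eqP.
rewrite -exprM mulnC exprM -[LHS]expF23_45; congr (_ ^+ 15).
apply: (mulfI n9); rewrite -E -exprM (mulnC 2 3) exprM.
move: (9%:R) n9 (z ^+ 3) => c c0 w.
by rewrite expr_div_n mulrCA [c ^+ 2]expr2 invfM mulVKf.
Qed.

Lemma delta_inj : injective delta_fun.
Proof.
have n9 := nine_neq0; have n9V : (9%:R : 'F_23)^-1 != 0 by rewrite invr_eq0.
case=> [x|] [y|] //; rewrite /delta_fun => /Some_inj.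
case: ifP => qx; case: ifP => qy E; congr Some.
- exact: cube_inj (mulIf n9V E).
- by rewrite (qr23_cube_mix qx E) in qy.
- by rewrite (qr23_cube_mix qy (esym E)) in qx.
- exact: cube_inj (mulfI n9 E).
Qed.

End Mathieu24.

(* Conway's generators: t |-> t + 1 and t |-> -1/t generate PSL(2, 23) on the
   projective line; adjoining delta, which sends t to t^3/9 if t is a square
   and to 9t^3 otherwise, gives the Mathieu group of degree 24 (Conway and
   Sloane, Sphere Packings, Lattices and Groups, Chapter 10). *)
Definition M24 : {group {perm PL23}} :=
  <<[set perm alpha_inj; perm gamma_inj; perm delta_inj]>>%G.

(* Main.v *)
Require Import Defs.
From mathcomp Require Import all_boot all_fingroup all_algebra.
From mathcomp Require Import finfield.

Set Implicit Arguments.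
Unset Strict Implicit.
Unset Printing Implicit Defensive.

(** Write S_i for the set of the first i points of the frame
    oo, 0, 2, 11, 5, 9, 1.  Everything rests on the setwise stabilisers of these
    sets in M24: for i <= 4 and i = 6 the stabiliser of S_i is transitive on the
    complement of S_i, and the stabiliser of S_5 is transitive on the 16 points
    outside the octad O through S_5 ([base_stab]; short words in the generators
    witness all this).  Hence all i-sets are equivalent under M24 for i <= 5
    ([homogeneous]), and a 6-set or a 7-set grown from an image of S_5 or S_6 in
    the same manner is an image of S_6 or S_7.

    For k <= 7 the set S_k witnesses the k-et property.  This is immediate for
    k <= 5.  A partition into 6 or 7 parts has a part B with more than 3 points;
    pick one point in each of 5 other parts.  By homogeneity these points lie in
    an image of O, which has only 3 further points, so B has a point outside it,
    and adding that point gives an image of S_6 ([umbral_section]).  When k = 7,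
    any point of the remaining part extends it to an image of S_7.

    For the negative part, M24 preserves the Golay code, defined here as the
    sets meeting 12 given octads evenly.  By homogeneity it has no nonempty
    member of size at most 6, as a few representatives show ([golay_small]).
    A partition into k - 1 singletons and one further part forces a k-et witness
    to contain an image of every (k - 1)-set.

    If 9 <= k <= 12, the witness S contains an image of a set containing O and
    an image of a (k - 1)-subset of a dodecad D.  As #|S| = k, some image of O
    meets D in at least 7 points, hence, by parity, is contained in D; the
    4 remaining points of D then form a codeword, which is impossible
    ([octad_dodecad]).

    If k = 8, then S has 7 points in an octad.  Six octads contain five points
    of S_6 each, and their remaining triples partition the complement of S_6.
    Split this complement into one of the triples and the union of the other
    five, and add the six singletons of S_6.  A section which is an image of S
    consists of S_6, a point x of the triple and a point y outside it, and all
    but at most one of its points lie in an octad X.  So X contains five points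
    of S_6, it is one of the six octads, and both x and y belong to its triple,
    a contradiction ([M24_not_et_8]). *)

(** * Sections of partitions *)

Section Sections.

Variables (T : finType) (G : {group {perm T}}).
Implicit Types (P : {set {set T}}) (A S : {set T}).

(** Partitions into k parts are the kernels of the maps of rank k, and for a
    k-set a section of such a kernel is a set on which the map is injective.
    Maps are easier to prescribe than partitions when ruling out a witness. *)
Lemma k_et_injective k : k_et G k ->
  exists2 S : {set T}, #|S| = k & forall f : T -> T, #|f @: setT| = k ->
    exists2 g : {perm T}, g \in G & {in g @: S &, injective f}.
Proof.
move=> [S cardS etS]; exists S => // f cardf.
have partf := preim_partitionP f setT.
have fiberE : preim_partition f setT = [set f @^-1: [set y] | y in f @: setT].
  rewrite -imset_comp; apply: eq_imset => x /=.
  by apply/setP=> y; rewrite !inE eq_sym.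
have fiber_inj : {in f @: setT &, injective (fun y => f @^-1: [set y])}.
  move=> _ y2 /imsetP[x _ ->] _ /setP/(_ x).
  by rewrite !inE eqxx => /esym/eqP.
have [|g gG /and3P[_ _ /forall_inP trg]] := etS _ partf.
  by rewrite fiberE card_in_imset.
exists g => // x y xS yS fxy.
have /trg/cards1P[z Ez] : f @^-1: [set f x] \in preim_partition f setT.
  by rewrite fiberE; apply/imset_f/imset_f.
have /[!Ez]/set1P-> : x \in g @: S :&: f @^-1: [set f x] by rewrite !inE xS /=.
have /[!Ez]/set1P-> // : y \in g @: S :&: f @^-1: [set f x].
by rewrite !inE yS fxy /=.
Qed.

(** The map that fixes A pointwise and collapses all other points to u has a
    kernel made of singletons and one other part. *)
Lemma sections_cover k S A u : #|S| = k.+1 ->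
    (forall f : T -> T, #|f @: setT| = k.+1 ->
      exists2 g : {perm T}, g \in G & {in g @: S &, injective f}) ->
    #|A| = k -> u \notin A ->
  exists2 g : {perm T}, g \in G & A \subset g @: S.
Proof.
move=> cardS etS cardA uA.
pose f x := if x \in A then x else u.
have imf : f @: setT = u |: A.
  apply/setP=> y; apply/imsetP/setU1P=> [[x _ ->]|[->|yA]].
  - by rewrite /f; case: ifP; [right | left].
  - by exists u; rewrite // /f (negPf uA).
  - by exists y; rewrite // /f yA.
have [|g gG inj_f] := etS f; first by rewrite imf cardsU1 uA cardA.
exists g => //; apply/subsetP=> x xA.
have: f @: (g @: S) == f @: setT.
  rewrite eqEcard imsetS ?subsetT // imf cardsU1 uA cardA card_in_imset //.
  by rewrite (card_imset _ (@perm_inj _ g)) cardS /= add1n.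
move/eqP/setP/(_ x); rewrite imf !inE xA orbT => /imsetP[y yS].
rewrite /f; case: ifP => [_ -> // | _ xu].
by rewrite -xu xA in uA.
Qed.

(** An injection of A into the set P of the same size is a bijection, so each
    block receives exactly one point of A. *)
Lemma transversal_pblock P A : partition P setT -> #|A| = #|P| ->
  {in A &, injective (pblock P)} -> is_transversal A P setT.
Proof.
move=> partP cardA injA; rewrite /is_transversal partP subsetT /=.
have [/eqP covP trivP _] := and3P partP.
have in_cov x : x \in cover P by rewrite covP.
have imA : pblock P @: A = P.
  apply/eqP; rewrite eqEcard card_in_imset // cardA leqnn andbT.
  by apply/subsetP=> _ /imsetP[x _ ->]; apply: pblock_mem.
apply/forall_inP=> B; rewrite -{1}imA => /imsetP[a aA ->].
apply/cards1P; exists a; apply/setP=> x; rewrite !inE.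
apply/andP/eqP=> [[xA /(same_pblock trivP)/injA-> //] | ->].
by rewrite mem_pblock.
Qed.

(** Partial sections are represented as the sets on which [pblock P] is
    injective. *)
Lemma extend_section P A m : partition P setT -> #|A| <= m <= #|P| ->
  {in A &, injective (pblock P)} ->
  exists A', [/\ A \subset A', #|A'| = m & {in A' &, injective (pblock P)}].
Proof.
move=> partP; have [/eqP covP trivP P0] := and3P partP.
elim: m => [|m IHm] in A *.
  by rewrite leqn0 andbT => /eqP cA injA; exists A.
case/andP=> [+ mP] injA; rewrite leq_eqVlt => /predU1P[cA|]; first by exists A.
rewrite ltnS => cA.
have [|A' [sAA' cA' injA']] := IHm A _ injA; first by rewrite cA ltnW.
have [B BP BA'] : exists2 B, B \in P & B \notin pblock P @: A'.
  apply/subsetPn; apply: contraL mP => /subset_leq_card.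
  by rewrite card_in_imset // cA' -leqNgt.
have [x xB] : exists x, x \in B.
  by apply/set0Pn; apply: contraNneq P0 => <-.
have Bx : pblock P x = B by apply: def_pblock.
have xA' y : y \in A' -> pblock P x != pblock P y.
  by move=> yA'; rewrite Bx; apply: contraNneq BA' => ->; apply: imset_f.
exists (x |: A'); split.
- exact: subset_trans sAA' (subsetUr _ _).
- by rewrite cardsU1 cA'; case: (boolP (x \in A')) => // /xA'; rewrite eqxx.
- move=> y z /setU1P[->|yA'] /setU1P[->|zA'] //; last exact: injA'.
    by move/eqP; rewrite (negPf (xA' _ zA')).
  by move/esym/eqP; rewrite (negPf (xA' _ yA')).
Qed.

Lemma big_block P m : partition P setT -> m * #|P| < #|T| ->
  exists2 B, B \in P & m < #|B|.
Proof.
move=> partP; rewrite -cardsT (card_partition partP) ltnNge => big.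
apply/exists_inP; apply: contraR big; rewrite negb_exists_in => /forall_inP small.
rewrite mulnC -sum_nat_const; apply: leq_sum => B /small.
by rewrite -leqNgt.
Qed.

Lemma imset_permM (g h : {perm T}) A : (g * h)%g @: A = h @: (g @: A).
Proof. by rewrite -imset_comp; apply: eq_imset => x /=; rewrite permM. Qed.

Lemma imset_permVK (g : {perm T}) A : g^-1%g @: (g @: A) = A.
Proof.
by rewrite -imset_permM mulgV; under eq_imset do rewrite perm1; rewrite imset_id.
Qed.

(** One step of a stabiliser chain, for the action on sets: an equivalence of S
    with A extends by one point as soon as the new points correspond under the
    setwise stabiliser of S. *)
Lemma extend_orbit S A b x (g h : {perm T}) :
    g \in G -> g @: S = A -> h \in G -> h @: S = S -> h b = (g^-1)%g x ->
  exists2 g' : {perm T}, g' \in G & g' @: (b |: S) = x |: A.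
Proof.
move=> gG gS hG hS hb; exists (h * g)%g; first exact: groupM.
by rewrite imset_permM !imsetU1 hS gS hb permKV.
Qed.

End Sections.

Section SymmetricDifference.

Variable T : finType.
Implicit Types X Y : {set T}.

Definition symdiff X Y := [set p | (p \in X) (+) (p \in Y)].

Lemma card_symdiff X Y : #|symdiff X Y| + #|X :&: Y|.*2 = #|X| + #|Y|.
Proof.
have -> : symdiff X Y = (X :\: Y) :|: (Y :\: X).
  by apply/setP=> p; rewrite !inE; do 2!case: (p \in _).
rewrite cardsU (_ : _ :&: _ = set0) ?cards0 ?subn0; last first.
  by apply/setP=> p; rewrite !inE; do 2!case: (p \in _).
rewrite -(cardsID Y X) -(cardsID X Y) (setIC Y) -addnn.
by rewrite addnC addnACA.
Qed.

Lemma symdiff_eq0 X Y : symdiff X Y = set0 -> X = Y.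
Proof.
by move/setP=> XY; apply/setP=> p; have := XY p; rewrite !inE; do 2!case: (p \in _).
Qed.

End SymmetricDifference.

(** * Computing with the generators *)

(** Points are computed with as natural numbers, infinity being 23. *)
Definition label (p : PL23) : nat := if p is Some x then val x else 23.

Definition point (i : nat) : PL23 := if i < 23 then Some (inZp i) else None.

Lemma label_lt p : label p < 24.
Proof. by case: p => //= x; apply: leq_trans (ltn_ord x) _. Qed.

Lemma labelK : cancel label point.
Proof.
case=> [x|] //=; have x23 : x < 23 by apply: ltn_ord.
by rewrite /point x23; congr Some; apply: valZpK.
Qed.

Lemma pointK i : i < 24 -> label (point i) = i.
Proof.
by rewrite ltnS leq_eqVlt => /predU1P[-> // | i23]; rewrite /point i23 /= modn_small.
Qed.

Lemma label_inj : injective label. Proof. exact: can_inj labelK. Qed.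

Lemma all_points (Q : pred nat) : all Q (iota 0 24) -> forall p, Q (label p).
Proof. by move/allP=> Q24 p; apply: Q24; rewrite mem_iota label_lt. Qed.

Lemma card_PL23 : #|PL23| = 24.
Proof. by rewrite card_option card_ord. Qed.

(** Euler's criterion, with 0 included, makes [qr23] computable. *)
Lemma qr23E x : qr23 x = (x ^+ 12 == x)%R.
Proof.
have F23 (y : 'F_23) : (y ^+ 23 = y)%R by have := expf_card y; rewrite card_Fp.
apply/existsP/eqP=> [[y /eqP->] | x12]; last first.
  by exists (x ^+ 6)%R; rewrite -GRing.exprM x12.
by rewrite -GRing.exprM -[(2 * 12)%N]/(23 + 1)%N GRing.exprD F23.
Qed.

Definition generators : seq {perm PL23} :=
  [:: perm alpha_inj; perm gamma_inj; perm delta_inj].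

Definition generator c := nth 1%g generators c.

Definition tables : seq (seq nat) :=
 [:: [:: 1; 2; 3; 4; 5; 6; 7; 8; 9; 10; 11; 12;
         13; 14; 15; 16; 17; 18; 19; 20; 21; 22; 0; 23];
     [:: 23; 22; 11; 15; 17; 9; 19; 13; 20; 5; 16; 2;
         21; 7; 18; 3; 10; 4; 14; 6; 8; 12; 1; 0];
     [:: 0; 18; 6; 3; 2; 21; 1; 5; 16; 12; 7; 19;
         8; 9; 17; 15; 13; 11; 4; 22; 10; 20; 14; 23]].

(** The default i makes an index outside the tables act trivially, just as
    [generator] is then the identity. *)
Definition gen_act c i := nth i (nth [::] tables c) i.

Lemma generator_M24 c : generator c \in M24.
Proof.
have [c3|c3] := ltnP c 3; last by rewrite /generator nth_default ?group1.
by apply: mem_gen; case: c c3 => [|[|[|]]] // _; rewrite /generator !inE eqxx ?orbT.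
Qed.

Lemma label_generator c p : label (generator c p) = gen_act c (label p).
Proof.
have [c3|c3] := ltnP c 3; last first.
  rewrite /generator [nth _ _ _]nth_default // perm1.
  by rewrite /gen_act [nth [::] _ _]nth_default // nth_nil.
(* Same as [delta_fun], with a test that reduces. *)
pose delta (q : PL23) : PL23 := (if q is Some x then
  Some (if x ^+ 12 == x then x ^+ 3 / 9%:R else 9%:R * x ^+ 3) else None)%R.
have deltaE q : delta_fun q = delta q by case: q => //= x; rewrite qr23E.
pose f := nth id [:: alpha_fun; gamma_fun; delta] c.
have -> : generator c p = f p.
  by rewrite /f; case: c c3 {f} => [|[|[|]]] // _; rewrite permE ?deltaE.
rewrite -[p]labelK pointK ?label_lt //; apply/eqP; move: p.
apply: (@all_points (fun i => label (f (point i)) == gen_act c i)).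
by rewrite /f; case: c c3 {f} => [|[|[|]]] // _; vm_compute.
Qed.

Definition word (w : seq nat) : {perm PL23} := (\prod_(c <- w) generator c)%g.

Definition word_act w i := foldl (fun j c => gen_act c j) i w.

Lemma word_M24 w : word w \in M24.
Proof. by apply: group_prod => c _; apply: generator_M24. Qed.

Lemma label_word w p : label (word w p) = word_act w (label p).
Proof.
elim: w p => [|c w IHw] p; first by rewrite /word big_nil perm1.
by rewrite /word big_cons permM IHw label_generator.
Qed.

Definition pts (s : seq nat) : {set PL23} := [set p | label p \in s].

Lemma card_pts s : uniq s -> all (gtn 24) s -> #|pts s| = size s.
Proof.
move=> Us /allP s24; rewrite -(size_map point) -(card_uniqP _); last first.
  by rewrite map_inj_in_uniq // => i j /s24/pointK{2}<- /s24/pointK{2}<- ->.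
apply: eq_card => p; rewrite inE; apply/idP/mapP=> [|[i /[dup] /s24/pointK<- + ->]].
  by exists (label p); rewrite ?labelK.
by rewrite labelK.
Qed.

Lemma pts_cons i s : i < 24 -> pts (i :: s) = point i |: pts s.
Proof.
by move=> i24; apply/setP=> p; rewrite !inE -(inj_eq label_inj) pointK.
Qed.

Lemma pts_cat s t : pts (s ++ t) = pts s :|: pts t.
Proof. by apply/setP=> p; rewrite !inE mem_cat. Qed.

(** * Homogeneity *)

Fixpoint reach (ws : seq (seq nat)) n (s : seq nat) :=
  if n is n'.+1 then
    reach ws n' (undup (s ++ [seq word_act w i | w <- ws, i <- s]))
  else s.

Definition stabilises s w := all (fun i => word_act w i \in s) s.

(** What the computation of [reach] means: labels reached from b lie in its
    orbit under the setwise stabiliser of s, as the words do not move s. *)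
Lemma reach_stab ws s b n x : all (stabilises s) ws -> b < 24 ->
    label x \in reach ws n [:: b] ->
  exists g : {perm PL23}, [/\ g \in M24, g @: pts s = pts s & g (point b) = x].
Proof.
move=> /allP stab b24.
pose good i := exists g : {perm PL23},
  [/\ g \in M24, g @: pts s = pts s & label (g (point b)) = i].
suffices reach_good r :
    {in r, forall i, good i} -> forall i, i \in reach ws n r -> good i.
  move/reach_good=> [_ /[1!inE]/eqP->|g [gG gs /label_inj gb]]; last by exists g.
  exists 1%g; rewrite group1 perm1 pointK //.
  by under eq_imset do rewrite perm1; rewrite imset_id.
elim: n r => //= n IHn r good_r; apply: IHn => i.
rewrite mem_undup mem_cat => /orP[/good_r // | /allpairsP[[w j] /= [ws_w rj ->]]].
have [g [gG gs gb]] := good_r j rj.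
exists (g * word w)%g; split; first by rewrite groupM ?word_M24.
  rewrite imset_permM gs; apply/eqP.
  rewrite eqEcard (card_imset _ (@perm_inj _ (word w))) leqnn andbT.
  apply/subsetP=> _ /imsetP[p + ->].
  by rewrite !inE label_word; move: (stab w ws_w) => /allP; apply.
by rewrite permM label_word gb.
Qed.

(** The first six points lie in no common octad; the first five lie in
    [octad]. *)
Definition frame := [:: 23; 0; 2; 11; 5; 9; 1].

Definition base k : {set PL23} := pts (take k frame).

Definition octad := [:: 0; 2; 4; 5; 6; 10; 11; 23].

(** Words in the setwise stabiliser of [base k].  Their joint orbits give the
    transitivity needed at each stage; for k = 3, for instance, the word is a
    21-cycle on the complement. *)
Definition stab_words k : seq (seq nat) :=
  match k with
  | 0 => [:: [:: 0]; [:: 1]]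
  | 1 => [:: [:: 0]]
  | 2 => [:: [:: 1]; [:: 0; 2; 0; 2; 0]]
  | 3 => [:: [:: 1; 2; 0; 0; 0; 0; 2]]
  | 4 => [:: [:: 1]; [:: 0; 2; 2; 0; 2; 2; 2; 0]]
  | 5 => [:: [:: 1; 0; 2; 2; 0; 2; 2; 2; 0]; [:: 2; 2; 0; 2; 0; 0; 0; 0; 0]]
  | _ => [:: [:: 1]; [:: 0; 0; 2; 2; 2; 2; 0; 0; 2; 0]]
  end.


Lemma forall_iota n (Q : pred nat) : all Q (iota 0 n) -> forall k, k < n -> Q k.
Proof. by move/allP=> Qn k kn; apply: Qn; rewrite mem_iota. Qed.

Lemma baseS k : k < 7 -> base k.+1 = point (nth 0 frame k) |: base k.
Proof.
move=> k7; rewrite -pts_cons.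
  by rewrite /base (take_nth 0) //; apply/setP=> p; rewrite !in_set mem_rcons.
by move: k k7; apply: forall_iota.
Qed.

Lemma card_base k : k <= 7 -> #|base k| = k.
Proof.
move=> k7; rewrite card_pts ?size_takel ?take_uniq //.
by apply/allP=> i /mem_take; apply/allP: i.
Qed.

Definition transitive_check k :=
  all (stabilises (take k frame)) (stab_words k) &&
  all (fun i => [|| i \in take k frame, (k == 5) && (i \in octad)
                  | i \in reach (stab_words k) 24 [:: nth 0 frame k]]) (iota 0 24).

(** The stabiliser of [base 5] also fixes the octad through [base 5], so only
    the points outside this octad can be exchanged when k = 5. *)
Lemma base_stab k x :
    k < 7 -> x \notin base k -> (k = 5 -> x \notin pts octad) ->
  exists g : {perm PL23},
    [/\ g \in M24, g @: base k = base k & g (point (nth 0 frame k)) = x].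
Proof.
move=> k7 xk xO.
have /andP[stab /all_points/(_ x)] : transitive_check k.
  by move: k k7 {xk xO}; apply: forall_iota; vm_compute.
have b24 : nth 0 frame k < 24 by move: k k7 {xk xO stab}; apply: forall_iota.
case/orP=> [xin|].
  by rewrite /base in_set xin in xk.
case/orP=> [/andP[/eqP/xO + xin] | xin].
  by rewrite in_set xin.
apply: (reach_stab stab b24 xin).
Qed.

(** Grow the set point by point, each new point being moved to the next point
    of the frame by the stabiliser of the previous ones. *)
Lemma homogeneous k (A : {set PL23}) : k <= 5 -> #|A| = k ->
  exists2 g : {perm PL23}, g \in M24 & g @: base k = A.
Proof.
elim: k A => [|k IHk] A k5 cA.
  exists 1%g; rewrite ?group1 //; move/eqP: cA; rewrite cards_eq0 => /eqP->.
  by apply/eqP; rewrite -cards_eq0 card_imset ?card_base //; apply: perm_inj.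
have /set0Pn[x xA] : A != set0 by rewrite -cards_eq0 cA.
have [|g gG gk] := IHk (A :\ x) (ltnW k5).
  by move: cA; rewrite (cardsD1 x) xA => -[].
have xk : (g^-1)%g x \notin base k.
  by rewrite -(mem_imset _ _ (@perm_inj _ g)) permKV gk !inE eqxx.
have k7 : k < 7 by apply: leq_trans k5 _.
have [|h [hG hk hb]] := base_stab k7 xk; first by move=> k5'; rewrite k5' in k5.
rewrite -(setD1K xA) baseS //; exact: extend_orbit gG gk hG hk hb.
Qed.

Lemma pts_subset s t : all [in t] s -> pts s \subset pts t.
Proof. by move/allP=> st; apply/subsetP=> p; rewrite !in_set => /st. Qed.

Lemma base6_orbit (g : {perm PL23}) (A : {set PL23}) x :
    g \in M24 -> g @: base 5 = A ->
  x \notin g @: pts octad -> 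
  exists2 g' : {perm PL23}, g' \in M24 & g' @: base 6 = x |: A.
Proof.
move=> gG gA; rewrite -{1}(permKV g x) (mem_imset _ _ (@perm_inj _ g)) => xO.
have [|h [hG hk hb]] := @base_stab 5 ((g^-1)%g x) isT _ (fun=> xO).
  by apply: contra xO; apply/subsetP/pts_subset.
by rewrite baseS //; apply: extend_orbit gG gA hG hk hb.
Qed.

Lemma base7_orbit (A : {set PL23}) x :
    (exists2 g : {perm PL23}, g \in M24 & g @: base 6 = A) ->
  x \notin A -> exists2 g : {perm PL23}, g \in M24 & g @: base 7 = x |: A.
Proof.
move=> [g gG gA] xA.
have [||h [hG hk hb]] := @base_stab 6 ((g^-1)%g x) isT.
- by rewrite -(mem_imset _ _ (@perm_inj _ g)) permKV gA.
- by [].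
by rewrite baseS //; apply: extend_orbit gG gA hG hk hb.
Qed.

(** * Sections in a single orbit *)

(** The size of a block B decides: a block with more than 3 points cannot be
    covered by the 3 points that complete a pentad to an octad.  The pentad is
    obtained from a section of 6 blocks through a point b of B, by
    dropping b. *)
Lemma umbral_section P : partition P [set: PL23] -> 6 <= #|P| <= 7 ->
  exists A : {set PL23}, [/\ #|A| = 6, {in A &, injective (pblock P)} &
    exists2 g : {perm PL23}, g \in M24 & g @: base 6 = A].
Proof.
move=> partP /andP[P6 P7]; have [_ trivP _] := and3P partP.
have [|B BP B3] := @big_block _ P 3 partP.
  by rewrite card_PL23 (@leq_ltn_trans (3 * 7)) // leq_mul2l P7.
have [b bB] : exists b, b \in B by apply/card_gt0P; apply: leq_trans B3.
have pB x : x \in B -> pblock P x = B by apply: def_pblock.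
have [||A' [/subsetP sA' cA' injA']] := @extend_section _ P [set b] 6 partP.
- by rewrite cards1.
- by move=> x y /set1P-> /set1P->.
have bA' : b \in A' by apply: sA'; rewrite set11.
pose A := A' :\ b.
have cA : #|A| = 5 by move: cA'; rewrite (cardsD1 b) bA' => -[].
have [g gG gA] := @homogeneous 5 A isT cA.
have AB x : x \in A -> pblock P x != B.
  rewrite !inE => /andP[xb xA']; apply: contra xb => /eqP xB.
  by apply/eqP/injA'; rewrite // xB pB.
have [x xB xO] : exists2 x, x \in B & x \notin g @: pts octad.
  apply/subsetPn; apply: contraL B3 => sBO; rewrite -leqNgt.
  suffices /subset_leq_card : B \subset g @: pts octad :\: A.
    rewrite -gA cardsDS; last exact/imsetS/pts_subset.
    by rewrite !(card_imset _ (@perm_inj _ g)) card_base ?card_pts.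
  apply/subsetP=> y yB; rewrite inE (subsetP sBO) // andbT.
  by apply/negP=> /AB; rewrite pB ?eqxx.
have xA : x \notin A by apply/negP=> /AB; rewrite pB ?eqxx.
exists (x |: A); split; first by rewrite cardsU1 xA cA.
- move=> y z /setU1P[->|yA] /setU1P[->|zA] //.
  + by rewrite pB // => /esym/eqP; rewrite (negPf (AB _ zA)).
  + by rewrite [in RHS]pB // => /eqP; rewrite (negPf (AB _ yA)).
  + by apply: injA'; [move: yA | move: zA]; case/setD1P.
- exact: base6_orbit gG gA xO.
Qed.

Lemma M24_et k : k <= 7 -> k_et M24 k.
Proof.
move=> k7; exists (base k); first exact: card_base.
move=> P partP cP.
suffices [A [cA injA [g gG gA]]] : exists A : {set PL23},
    [/\ #|A| = k, {in A &, injective (pblock P)} &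
      exists2 g : {perm PL23}, g \in M24 & g @: base k = A].
  by exists g; rewrite // gA; apply: transversal_pblock; rewrite // cA.
have [k5|k6] := leqP k 5.
  have [||A [_ cA injA]] := @extend_section _ P set0 k partP.
  - by rewrite cards0 cP /=.
  - by move=> x; rewrite inE.
  by exists A; split=> //; apply: homogeneous.
have [|A [cA injA orbA]] := umbral_section partP; first by rewrite cP k6.
move: k7; rewrite leq_eqVlt ltnS => /predU1P[k7|k6']; last first.
  by have <- : 6 = k; [apply/eqP; rewrite eqn_leq k6 | exists A].
have [|A' [sAA' cA' injA']] := @extend_section _ P A 7 partP _ injA.
  by rewrite cA cP k7.
exists A'; split; rewrite ?k7 //.
have /cards1P[y yA'] : #|A' :\: A| == 1 by rewrite cardsDS // cA cA'.
have yA : y \in A' :\: A by rewrite yA' set11.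
rewrite -(setID A' A) (setIidPr sAA') yA' setUC.
by apply: base7_orbit orbA _; case/setDP: yA.
Qed.

(** * The Golay code *)

(** A basis of the extended quadratic residue code of length 24 over the field
    with 2 elements, in standard form: each word has a single label below 12,
    listed first, and it differs from word to word.  All words are octads. *)
Definition golay_basis : seq (seq nat) :=
 [:: [:: 0; 12; 14; 16; 17; 18; 22; 23];
     [:: 1; 12; 13; 14; 15; 16; 19; 22];
     [:: 2; 12; 13; 15; 18; 20; 22; 23];
     [:: 3; 12; 13; 17; 18; 19; 21; 22];
     [:: 4; 12; 13; 16; 17; 19; 20; 23];
     [:: 5; 13; 14; 17; 18; 20; 21; 23];
     [:: 6; 14; 15; 18; 19; 21; 22; 23];
     [:: 7; 12; 14; 15; 17; 18; 19; 20];
     [:: 8; 13; 15; 16; 18; 19; 20; 21];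
     [:: 9; 14; 16; 17; 19; 20; 21; 22];
     [:: 10; 12; 14; 15; 16; 20; 21; 23];
     [:: 11; 13; 15; 16; 17; 21; 22; 23]].

Definition overlap (X : {set PL23}) (s : seq nat) := odd #|X :&: pts s|.

(** The code is self-dual, so the orthogonal of the basis is the code itself.
    Membership in the orthogonal is a matter of 12 parities. *)
Definition golay X := all (fun s => ~~ overlap X s) golay_basis.

Lemma overlapE X s :
  overlap X s = \big[addb/false]_p ((p \in X) && (label p \in s)).
Proof.
rewrite /overlap -sum1_card (big_morph odd oddD (erefl : odd 0 = false)).
by rewrite big_mkcond; apply: eq_bigr => p _; rewrite !inE; case: ifP.
Qed.

Lemma overlap_pts s t : uniq s -> all (gtn 24) s ->
  overlap (pts s) t = odd (count [in t] s).
Proof.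
move=> Us /allP s24; rewrite /overlap -size_filter; congr odd.
rewrite -card_pts ?filter_uniq //; last first.
  by apply/allP=> i; rewrite mem_filter => /andP[_ /s24].
by apply: eq_card => p; rewrite !in_set mem_filter andbC.
Qed.

Definition golay_labels (s : seq nat) :=
  all (fun t => ~~ odd (count [in t] s)) golay_basis.

Lemma golay_pts s : uniq s -> all (gtn 24) s -> golay (pts s) = golay_labels s.
Proof. by move=> Us s24; apply: eq_all => t; rewrite overlap_pts. Qed.

(** As the basis is in standard form, a word of the code is the sum of the basis
    words whose heads it contains. *)
Definition golay_span (s : seq nat) := all (fun i =>
  (i \in s) == odd (count (fun t => (head 24 t \in s) && (i \in t)) golay_basis))
  (iota 0 24).

(** Parities of intersections are additive in the second set. *)
Lemma overlap_span X s : golay_span s -> golay X -> ~~ overlap X s.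
Proof.
move=> /all_points span_s gX; rewrite overlapE.
under eq_bigr => p _.
  rewrite (eqP (span_s p)) -sum1_count (big_morph odd oddD (erefl : odd 0 = false)).
  rewrite big_mkcondr big_distrr /=.
  over.
rewrite exchange_big big1_seq //= => t /andP[_ tB].
transitivity (overlap X t); last by apply/negbTE; apply: (allP gX).
by rewrite overlapE; apply: eq_bigr => p _; case: (_ \in t).
Qed.

(** An image of X meets a basis word s as X meets the preimage of s, and that
    preimage is a sum of basis words. *)
Lemma golay_generator c X : golay X -> golay (generator c @: X).
Proof.
move=> gX; apply/allP=> s sB.
have [c3|c3] := ltnP c 3; last first.
  rewrite /generator nth_default //; under eq_imset do rewrite perm1.
  by rewrite imset_id; apply: (allP gX).
have span_c :
    all (fun t => golay_span [seq i <- iota 0 24 | gen_act c i \in t]) golay_basis.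
  by case: c c3 => [|[|[|]]] // _; vm_compute.
pose s' := [seq i <- iota 0 24 | gen_act c i \in s].
suffices <- : overlap X s' = overlap (generator c @: X) s.
  exact: (overlap_span (allP span_c s sB) gX).
rewrite /overlap -(card_imset _ (@perm_inj _ (generator c))).
congr (odd #|(_ : {set _})|).
rewrite imsetI; last by move=> ? ? _ _; apply: perm_inj.
apply/setP=> p; rewrite !in_setI; congr (_ && _).
rewrite -[p](permKV (generator c)) (mem_imset _ _ (@perm_inj _ _)) !in_set.
by rewrite label_generator mem_filter mem_iota leq0n label_lt !andbT.
Qed.

Lemma golay_M24 g X : g \in M24 -> golay X -> golay (g @: X).
Proof.
case/gen_prodgP=> n [h hgen ->].
have {}hgen i : exists c, h i = generator c.
  have := hgen i; rewrite !inE -orbA => /or3P[] /eqP->.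
  - by exists 0.
  - by exists 1.
  - by exists 2.
elim: n => [|n IHn] in h hgen X *.
  by rewrite big_ord0; under eq_imset do rewrite perm1; rewrite imset_id.
rewrite big_ord_recl imset_permM => gX; apply: IHn => //.
by have [c ->] := hgen ord0; apply: golay_generator.
Qed.

Lemma golay_symdiff X Y : golay X -> golay Y -> golay (symdiff X Y).
Proof.
move=> /allP gX /allP gY; apply/allP=> s sB.
suffices -> : overlap (symdiff X Y) s = overlap X s (+) overlap Y s.
  by rewrite (negPf (gX s sB)) (negPf (gY s sB)).
rewrite !overlapE -big_split; apply: eq_bigr => p _ /=.
by rewrite in_set andb_addl.
Qed.

(** By homogeneity it is enough to exclude [base i] for i <= 5, and
    [base 5] with one more point. *)
Lemma golay_small X : golay X -> #|X| <= 6 -> X = set0.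
Proof.
move=> gX cX; apply/eqP/negPn/negP=> X0; move: gX; apply/negP.
have pullback (g : {perm PL23}) s : g \in M24 -> g @: pts s = X ->
  uniq s && all (gtn 24) s && ~~ golay_labels s -> ~~ golay X.
  move=> gG <- /andP[/andP[Us s24]]; rewrite -golay_pts //; apply: contra.
  by move/(golay_M24 (groupVr gG)); rewrite imset_permVK.
have [k5|k6] := leqP #|X| 5.
  have [g gG gX] := homogeneous k5 (erefl _).
  apply: pullback gG gX _; move: k5 X0; rewrite -card_gt0.
  by case: #|X| => [|[|[|[|[|[|]]]]]] // _ _; vm_compute.
have [x xX] := set0Pn _ X0.
have cX6 : #|X| = 6 by apply/eqP; rewrite eqn_leq cX.
have [|g gG gX] := @homogeneous 5 (X :\ x) isT.
  by move: cX6; rewrite (cardsD1 x) xX => -[].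
pose y := (g^-1)%g x.
apply: (@pullback g (label y :: take 5 frame)) => //.
  by rewrite pts_cons ?label_lt // labelK imsetU1 permKV gX setD1K.
have : y \notin base 5.
  by rewrite -(mem_imset _ _ (@perm_inj _ g)) permKV gX !inE eqxx.
rewrite /base in_set; move: (label y) (label_lt y) => {y}.
by move=> i i24; apply/implyP; move: i i24; apply: forall_iota; vm_compute.
Qed.

(** * No witness of size 8 to 12 *)

(** The squares modulo 23 form a dodecad. *)
Definition squares := [:: 0; 1; 2; 3; 4; 6; 8; 9; 12; 13; 16; 18].

Lemma golay_octad : golay (pts octad).
Proof. by rewrite golay_pts. Qed.

(** The intersection is even, and if it had 8 points then the other 4 points of
    the dodecad would form a codeword. *)
Lemma octad_dodecad (g : {perm PL23}) : g \in M24 ->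
  #|g @: pts octad :&: pts squares| <= 6.
Proof.
move=> gG; set X := g @: _; set D := pts squares.
have gX : golay X := golay_M24 gG golay_octad.
have gD : golay D by rewrite golay_pts.
have cX : #|X| = 8 by rewrite (card_imset _ (@perm_inj _ g)) card_pts.
have cD : #|D| = 12 by rewrite card_pts.
have evenXD : ~~ odd #|X :&: D|.
  exact: (overlap_span (isT : golay_span squares) gX).
rewrite leqNgt; apply: contraNN evenXD => XD7.
have cXD := card_symdiff X D.
have [XD8|XD8] := leqP 8 #|X :&: D|; last first.
  by have -> : #|X :&: D| = 7 by apply/eqP; rewrite eqn_leq XD7 andbT -ltnS.
have XD0 : symdiff X D = set0.
  apply: golay_small (golay_symdiff gX gD) _.
  rewrite -(leq_add2r #|X :&: D|.*2) cXD cX cD.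
  by apply: (@leq_trans (6 + 8.*2)); rewrite // leq_add2l leq_double.
by move: cX; rewrite (symdiff_eq0 XD0) cD.
Qed.

(** The two forced subsets, one through an octad and one inside a dodecad, have
    8 and k points in a set of size k + 1, so they share at least 7 points. *)
Lemma M24_not_et_ge9 k : 8 <= k <= 11 -> ~ k_et M24 k.+1.
Proof.
case/andP=> k8 k11 /k_et_injective[S cS etS].
have take_ok s : uniq s -> all (gtn 24) s -> 11 < size s ->
  exists2 g : {perm PL23}, g \in M24 & pts (take k s) \subset g @: S.
  move=> Us s24 ss; have ks : k < size s by apply: leq_ltn_trans ss.
  apply: (sections_cover (u := point (nth 0 s k)) cS etS).
    rewrite card_pts ?take_uniq ?size_takel // 1?ltnW //.
    by apply/allP=> i /mem_take; apply: (allP s24).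
  rewrite in_set pointK; last by apply/(allP s24)/mem_nth.
  move: Us; rewrite -{1}(cat_take_drop k s) (drop_nth 0) // uniq_catC /=.
  by case/andP; rewrite mem_cat negb_or => /andP[].
(* The four appended labels only bring the length of the list to 12. *)
have [//|//|//|g gG Xg] := take_ok (octad ++ [:: 1; 3; 7; 8]).
have [//|//|//|h hG Dh] := take_ok squares.
have := octad_dodecad (groupM (groupVr gG) hG); apply/negP; rewrite -ltnNge.
set X := _ @: _; rewrite -(leq_add2l #|X :|: pts (take k squares)|).
have XS : X \subset h @: S.
  rewrite /X imset_permM imsetS // -(imset_permVK g S) imsetS //.
  apply: subset_trans Xg.
  by rewrite take_cat ltnNge k8 pts_cat subsetUl.
apply: (@leq_trans (#|X :|: pts (take k squares)| + #|X :&: pts (take k squares)|)); last first.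
  rewrite leq_add2l subset_leq_card // setIS // pts_subset //.
  by apply/allP=> i; apply: mem_take.
rewrite cardsUI (card_imset _ (@perm_inj _ _)) !card_pts ?take_uniq //; last first.
  by apply/allP=> i /mem_take; apply/allP: i.
rewrite size_takel; last exact: leq_trans k11 _.
have : #|X :|: pts (take k squares)| <= k.+1.
  rewrite -cS -[#|S|](card_imset _ (@perm_inj _ h)) subset_leq_card // subUset XS.
  exact: Dh.
by move=> cU; rewrite -[size octad]/8 addnC (addSnnS 7) leq_add2l.
Qed.

Definition hexad : seq nat := take 6 frame.

(** The octad in position j contains all points of the hexad but the j-th. *)
Definition hexad_octads : seq (seq nat) :=
  [:: [:: 0; 2; 5; 8; 9; 11; 14; 15];
      [:: 2; 3; 5; 9; 11; 18; 20; 23];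
      [:: 0; 1; 5; 9; 11; 13; 21; 23];
      [:: 0; 2; 5; 7; 9; 12; 22; 23];
      [:: 0; 2; 9; 11; 16; 17; 19; 23];
      octad].

(** The points of [octad] outside the hexad. *)
Definition triple : seq nat := [:: 4; 6; 10].

(** Two octads sharing five points differ by a codeword of size at most 6. *)
Lemma octad_through_pentad X O (A : {set PL23}) :
    golay X -> golay O -> #|X| = 8 -> #|O| = 8 ->
  A \subset X :&: O -> 5 <= #|A| -> X = O.
Proof.
move=> gX gO cX cO AXO A5; apply/symdiff_eq0/golay_small; first exact: golay_symdiff.
rewrite -(leq_add2r #|X :&: O|.*2) card_symdiff cX cO.
apply: (@leq_trans (6 + 5.*2)); rewrite // leq_add2l leq_double.
exact: leq_trans A5 (subset_leq_card AXO).
Qed.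

Lemma hexad_octadsP j (O := nth [::] hexad_octads j) : j < 6 ->
  [/\ golay (pts O), #|pts O| = 8, nth 0 hexad j \notin O &
      {subset rem (nth 0 hexad j) hexad <= O}].
Proof.
move=> j6.
have /and3P[/and4P[Us s24 gO s8] h1 h2] :
  [&& [&& uniq O, all (gtn 24) O, golay_labels O
        & size O == 8],
      nth 0 hexad j \notin O & all [in O] (rem (nth 0 hexad j) hexad)].
  by move: j j6 @O; apply: forall_iota; vm_compute.
by split; rewrite ?golay_pts ?card_pts //; [apply/eqP | apply/allP].
Qed.

(** An octad X containing five points of the hexad is one of the six octads
    above, as these already account for all pentads of the hexad.  The last
    conclusion holds because the octads meet pairwise inside the hexad, and
    [octad] is the one that contains the triple. *)
Lemma hexad_octad X : golay X -> #|X| = 8 ->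
    {in hexad &, forall i j, i != j -> (point i \in X) || (point j \in X)} ->
  exists2 i, i \in hexad & exists O, [/\ X = pts O, i \notin O &
    has [in triple] O -> all [in hexad ++ triple] O].
Proof.
move=> gX cX two_hex.
have [j j6 jX] : exists2 j, j < 6 &
    {subset rem (nth 0 hexad j) hexad <= [pred i | point i \in X]}.
  have [/allP all_in | /allPn[i ih iX]] := boolP (all [pred i | point i \in X] hexad).
    by exists 0 => // i /mem_rem/all_in.
  exists (index i hexad); first by rewrite -[6]/(size hexad) index_mem.
  rewrite nth_index // => k; rewrite mem_rem_uniq // inE => /andP[ki kh].
  have /negPf iX' : point i \notin X := iX.
  by have := two_hex i k ih kh; rewrite eq_sym iX' ki => /(_ isT).
have [gO cO jO hO] := hexad_octadsP j6; set O := nth _ _ _ in gO cO jO hO.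
have jh : nth 0 hexad j \in hexad by rewrite mem_nth.
exists (nth 0 hexad j) => //; exists O; split=> //; last first.
  by apply/implyP; move: j j6 @O {jX gO cO jO hO jh}; apply: forall_iota.
apply: (@octad_through_pentad _ _ (pts (rem (nth 0 hexad j) hexad))) => //.
  apply/subsetP=> p; rewrite !inE => ph.
  by rewrite hO // andbT; have /= := jX _ ph; rewrite inE labelK.
rewrite card_pts ?rem_uniq ?size_rem //.
by apply/allP=> i /mem_rem; apply/allP: i.
Qed.

Lemma M24_not_et_8 : ~ k_et M24 8.
Proof.
move=> /k_et_injective[S cS etS].
have [||h hG octS] :=
  sections_cover (A := pts (take 7 octad)) (u := point 1) cS etS.
- by rewrite card_pts.
- by rewrite in_set pointK.
(* The kernel of f is the partition into the singletons of the hexad, the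
   triple and the remaining points; 4 and 1 represent the last two parts. *)
pose f p := if label p \in hexad then p
  else if label p \in triple then point 4 else point 1.
have imf : f @: setT = pts (hexad ++ [:: 4; 1]).
  apply/setP=> p; rewrite in_set; apply/imsetP/idP=> [[q _ ->] | pR].
    rewrite /f mem_cat; case: ifP => [-> // | _].
    by case: ifP => _; rewrite pointK.
  exists p => //; rewrite /f; move: pR; rewrite mem_cat => /orP[-> // |].
  by rewrite !in_cons orbF => /orP[] /eqP pE; rewrite -[p]labelK pE pointK.
have [|g gG inj_f] := etS f; first by rewrite imf card_pts.
set S' := g @: S in inj_f.
have cS' : #|S'| = 8 by rewrite (card_imset _ (@perm_inj _ g)).
have imS' : f @: S' = pts (hexad ++ [:: 4; 1]).
  apply/eqP; rewrite eqEcard (card_in_imset inj_f) cS' card_pts //.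
  by rewrite -imf imsetS ?subsetT.
have hexS' i : i \in hexad -> point i \in S'.
  move=> ih; have i24 : i < 24 by move: i ih; apply/allP.
  have : point i \in f @: S' by rewrite imS' in_set pointK // mem_cat ih.
  case/imsetP=> q qS'; rewrite /f; case: ifP => [_ -> // | _ /(congr1 label)].
  by case: ifP => _; rewrite !pointK // => iE; rewrite iE in ih.
have [x xS' xt] : exists2 x, x \in S' & label x \in triple.
  have : point 4 \in f @: S' by rewrite imS' in_set pointK.
  case/imsetP=> q qS'; rewrite /f; case: ifP => [qh q4 | _].
    by rewrite -q4 pointK in qh.
  case: ifP => [qt _ | _ /(congr1 label)]; first by exists q.
  by rewrite !pointK.
have [y yS' yt] : exists2 y, y \in S' & label y \notin hexad ++ triple.
  have : point 1 \in f @: S' by rewrite imS' in_set pointK.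
  case/imsetP=> q qS'; rewrite /f; case: ifP => [qh q1 | qh].
    by rewrite -q1 pointK in qh.
  case: ifP => [_ /(congr1 label) | qt _]; first by rewrite !pointK.
  by exists q; rewrite // mem_cat qh qt.
(* [S'] has 8 points, of which at least 7 lie in the octad [X]. *)
set X := g @: (h^-1%g @: pts octad).
have gX : golay X by apply/golay_M24/golay_M24; rewrite ?groupV // golay_octad.
have cX : #|X| = 8 by rewrite !(card_imset _ (@perm_inj _ _)) card_pts.
have two p q : p \in S' -> q \in S' -> p != q -> (p \in X) || (q \in X).
  move=> pS' qS' pq; rewrite -[_ || _]negbK negb_or; apply/negP=> /andP[pX qX].
  have : #|[set p; q] :|: g @: (h^-1%g @: pts (take 7 octad))| <= #|S'|.
    rewrite subset_leq_card // subUset subUset !sub1set pS' qS' /= imsetS //.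
    by rewrite -(imset_permVK h S) imsetS.
  rewrite cardsU cards2 pq !(card_imset _ (@perm_inj _ _)) card_pts //.
  rewrite (_ : _ :&: _ = set0) ?cards0 ?cS //.
  apply/setP=> r; rewrite !inE; apply/andP=> [[rpq rX]].
  suffices: r \in X by case/orP: rpq => /eqP->; rewrite ?(negPf pX) ?(negPf qX).
  by apply: subsetP rX; rewrite !imsetS // pts_subset.
have [|i ih [O [XO iO trO]]] := hexad_octad gX cX.
  move=> i j ih jh ij; apply: two; rewrite ?hexS' //.
  apply: contra ij => /eqP/(congr1 label); rewrite !pointK; first by move->.
  - by move: j jh; apply/allP.
  - by move: i ih {hexS'}; apply/allP.
have i24 : i < 24 by move: i ih {iO}; apply/allP.
have memO p : p \in S' -> label p != i -> label p \in O.
  move=> pS' pi; have := two p (point i) pS' (hexS' i ih).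
  rewrite -(inj_eq label_inj) pointK // => /(_ pi).
  by rewrite XO !in_set pointK // (negPf iO) orbF.
have tri_hex : all [predC hexad] triple by [].
have xO : label x \in O.
  apply: memO => //; apply: contraTneq ih => <-.
  exact: (allP tri_hex).
have : label y \in hexad ++ triple.
  apply: (allP (trO _)); first by apply/hasP; exists (label x).
  by apply: memO => //; apply: contraNneq yt => ->; rewrite mem_cat ih.
by rewrite (negPf yt).
Qed.

Theorem theorem3p2 :
  (forall k : nat, 1 <= k <= 7 -> k_et M24 k) /\
  (forall k : nat, 8 <= k <= 12 -> ~ k_et M24 k).
Proof.
split=> k /andP[]; first by move=> _; apply: M24_et.
case: k => // k; rewrite leq_eqVlt => /predU1P[<- _|k8 k12].
  exact: M24_not_et_8.
by apply: M24_not_et_ge9; rewrite -ltnS k8.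
Qed.
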